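(* Let $\mathcal{C}$ be a collection of pairs $((X,d),(a_n)_{n\in\mathbb{N}})$, where each $(X,d)$ is a metric space and $(a_n)_{n\in\mathbb{N}}$ is a sequence of elements of $X$. Let $h:\mathbb{N}\to\mathbb{N}$ be a weakly increasing function with $n<h(n)$ for all $n$. The following are equivalent: (1) For every real $\epsilon>0$ there is a $K\in\mathbb{N}$ such that, for every $((X,d),(a_n)_{n\in\mathbb{N}})\in\mathcal{C}$, the sequence $(a_n)_{n\in\mathbb{N}}$ does not admit $K$ $\epsilon$-jumps of distance $h$. (2) Whenever $\mathcal{U}$ is a nonprincipal ultrafilter on $\mathbb{N}$ and, for each $i\in\mathbb{N}$, $((X_i,d_i),(a^i_n)_{n\in\mathbb{N}})\in\mathcal{C}$, the extended sequence $(a_{\bar n})_{\bar n\in\mathbb{N}^*}$ in the metric ultraproduct $(X_{\mathcal{U}},d_{\mathcal{U}})=\prod_{\mathcal{U}}(X_i,d_i)$ converges in every cut $I\subseteq\mathbb{N}^*$ that is closed under $h$.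
   Context: Jumps of distance $h$: a sequence $(a_n)_{n\in\mathbb{N}}$ in a metric space $(X,d)$ admits $K$ $\epsilon$-jumps of distance $h$ if there are $n_1<n_2<\cdots<n_K$ in $\mathbb{N}$ such that, for each $1\le k<K$, $h(n_k)\le n_{k+1}$ and $d(a_{n_k},a_{n_{k+1}})\ge\epsilon$. Let $\mathcal{U}$ be a nonprincipal ultrafilter on $\mathbb{N}$. Ultralimit: for reals $(r_i)_{i\in\mathbb{N}}$ such that $\{i : |r_i|\le B\}\in\mathcal{U}$ for some $B$, $\lim_{\mathcal{U}} r_i$ is the unique $r\in\mathbb{R}$ such that $\{i : |r_i-r|<\epsilon\}\in\mathcal{U}$ for every $\epsilon>0$. Metric ultraproduct: for metric spaces $(X_i,d_i)$, $i\in\mathbb{N}$, let $X_{\mathcal{U}}$ be the set of all sequences $\langle x_i\rangle_{i\in\mathbb{N}}$ with $x_i\in X_i$, modulo the equivalence relation $\langle x_i\rangle\sim\langle y_i\rangle$ iff $\lim_{\mathcal{U}}d_i(x_i,y_i)=0$. Set $d_{\mathcal{U}}([\langle x_i\rangle],[\langle y_i\rangle])=\lim_{\mathcal{U}}d_i(x_i,y_i)$ if this ultralimit exists, and $\infty$ otherwise (so $d_{\mathcal{U}}$ may take the value $\infty$). Nonstandard natural numbers: $\mathbb{N}^*$ (relative to $\mathcal{U}$) is the set of sequences $\langle n_i\rangle_{i\in\mathbb{N}}$ of natural numbers modulo the relation $\{i : n_i=m_i\}\in\mathcal{U}$, with order and arithmetic defined coordinatewise modulo $\mathcal{U}$. Extended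 sequence: given sequences $(a^i_n)_{n\in\mathbb{N}}$ in $X_i$, for $\bar n=[\langle n_i\rangle]\in\mathbb{N}^*$ put $a_{\bar n}=[\langle a^i_{n_i}\rangle]\in X_{\mathcal{U}}$ (this is well defined). Cut: a cut in $\mathbb{N}^*$ is a nonempty initial segment $I\subseteq\mathbb{N}^*$ such that $\bar n\in I$ implies $\bar n+1\in I$. Let $\bar h:\mathbb{N}^*\to\mathbb{N}^*$ be given by $\bar h([\langle n_i\rangle])=[\langle h(n_i)\rangle]$. A cut $I$ is closed under $h$ if $\bar h(\bar n)\in I$ for every $\bar n\in I$. Convergence in a cut: $(a_{\bar n})_{\bar n\in\mathbb{N}^*}$ converges in $I$ if for every real $\epsilon>0$ there is an $\bar n\in I$ such that for all $\bar m\in I$ with $\bar m>\bar n$, $d_{\mathcal{U}}(a_{\bar n},a_{\bar m})<\epsilon$. *)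

(* Defs.v *)
From HB Require Import structures.
From mathcomp Require Import all_boot all_order all_algebra generic_quotient.
From mathcomp Require Import all_classical all_reals all_analysis.
From mathcomp Require Import lra.

Set Implicit Arguments.
Unset Strict Implicit.
Unset Printing Implicit Defensive.

Import Order.TTheory GRing.Theory Num.Theory.
Import numFieldNormedType.Exports.

Local Open Scope classical_set_scope.
Local Open Scope ring_scope.
Local Open Scope quotient_scope.

(* Only the values n 1, ..., n K matter. *)
Definition admits_jumps (R : realType) (X : metricType R) (h : nat -> nat)
    (eps : R) (K : nat) (a : nat -> X) : Prop :=
  exists n : nat -> nat, forall k, (1 <= k < K)%N ->
    [/\ (n k < n k.+1)%N, (h (n k) <= n k.+1)%N &
        eps <= mdist (a (n k)) (a (n k.+1))].

Record nonprincipal_ultrafilter := NonprincipalUltrafilter {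
  ultra : set_system nat ;
  ultra_ultra : UltraFilter ultra ;
  ultra_nonprincipal : forall n, ultra <> principal_filter n
}.
#[global] Existing Instance ultra_ultra.

Section Hypernat.
Variable U : nonprincipal_ultrafilter.

Definition hypernat_eqv (n m : nat -> nat) : bool :=
  `[< ultra U [set i | n i = m i] >].

Lemma hypernat_eqv_refl : reflexive hypernat_eqv.
Proof. by move=> n; apply/asboolP; apply: filterE. Qed.

Lemma hypernat_eqv_sym : symmetric hypernat_eqv.
Proof.
by move=> n m; apply/asboolP/asboolP; apply: filterS => i /= ->.
Qed.

Lemma hypernat_eqv_trans : transitive hypernat_eqv.
Proof.
move=> m n p /asboolP nm /asboolP mp; apply/asboolP.
by apply: filterS2 nm mp => i /= -> ->.
Qed.

Canonical hypernat_equiv :=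
  EquivRel hypernat_eqv hypernat_eqv_refl hypernat_eqv_sym hypernat_eqv_trans.

Definition hypernat := {eq_quot hypernat_eqv}.

(* Coordinatewise on representatives; hn_leE, hn_ltE, hn_mapE show that the
   choice of representatives does not matter. *)
Definition hn_le (n m : hypernat) : Prop :=
  ultra U [set i | (repr n i <= repr m i)%N].

Definition hn_lt (n m : hypernat) : Prop :=
  ultra U [set i | (repr n i < repr m i)%N].

Definition hn_map (f : nat -> nat) (n : hypernat) : hypernat :=
  \pi_hypernat (fun i => f (repr n i)).

Lemma hypernat_piP (n m : nat -> nat) :
  \pi_hypernat n = \pi_hypernat m <-> ultra U [set i | n i = m i].
Proof.
have eqP := @eqmodP _ hypernat_equiv n m.
by split=> [/eqP/asboolP|/asboolP/eqP].
Qed.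

Lemma hypernat_reprP (n : nat -> nat) :
  ultra U [set i | repr (\pi_hypernat n) i = n i].
Proof. by apply/hypernat_piP; rewrite reprK. Qed.

Lemma hn_leE (n m : nat -> nat) :
  hn_le (\pi n) (\pi m) <-> ultra U [set i | (n i <= m i)%N].
Proof.
have n_ := hypernat_reprP n; have m_ := hypernat_reprP m.
by split; move: n_ m_; apply: filterS3 => i /= -> ->.
Qed.

Lemma hn_ltE (n m : nat -> nat) :
  hn_lt (\pi n) (\pi m) <-> ultra U [set i | (n i < m i)%N].
Proof.
have n_ := hypernat_reprP n; have m_ := hypernat_reprP m.
by split; move: n_ m_; apply: filterS3 => i /= -> ->.
Qed.

Lemma hn_mapE (f n : nat -> nat) :
  hn_map f (\pi n) = \pi_hypernat (fun i => f (n i)).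
Proof.
apply/hypernat_piP; apply: filterS (hypernat_reprP n) => i /= -> //.
Qed.

Definition is_cut (I : set hypernat) : Prop :=
  [/\ I !=set0,
      forall n m, hn_le m n -> I n -> I m &
      forall n, I n -> I (hn_map succn n)].

Definition closed_under (h : nat -> nat) (I : set hypernat) : Prop :=
  forall n, I n -> I (hn_map h n).

End Hypernat.

Section Ultralimit.
Variables (R : realType) (U : nonprincipal_ultrafilter).

(* By cvg_ultraP, +oo is returned exactly when r is bounded on no set of the
   ultrafilter. *)
Definition ultralim (r : nat -> R) : \bar R :=
  if `[< cvg (r @ ultra U) >] then (lim (r @ ultra U))%:E else +oo%E.

Lemma cvg_ultraP (r : nat -> R) :
  cvg (r @ ultra U) <-> exists B, ultra U [set i | `|r i| <= B].
Proof.
split=> [cr|[B rB]].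
  exists (`|lim (r @ ultra U)| + 1); move/cvgrPdist_le : cr => /(_ 1 ltr01).
  apply: filterS => i /= ri.
  rewrite -(subrK (lim (r @ ultra U)) (r i)) (le_trans (ler_normD _ _))//.
  by rewrite addrC lerD2l distrC.
have := @segment_compact R (- B) B; rewrite compact_ultra => /(_ (r @ ultra U)).
case; [|by apply: filterS rB => i /=; rewrite in_itv/= ler_norml|by move=> l [_ rl]; apply/cvg_ex; exists l].
split=> [|G GF UG]; first exact: fmap_proper_filter.
apply/seteqP; split=> // A GA.
have [//|UA] := in_ultra_setVsetC (r @^-1` A) (ultra_ultra U).
have : G (A `&` ~` A) by apply: filterI => //; exact: UG.
by rewrite setICr => /filter_not_empty.
Qed.

Lemma ultralim_cvg (r : nat -> R) (l : R) :
  r @ ultra U --> l -> ultralim r = l%:E.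
Proof.
move=> rl; rewrite /ultralim asboolT; last by apply/cvg_ex; exists l.
by rewrite (cvg_lim _ rl).
Qed.

End Ultralimit.

Section Ultraproduct.
Variables (R : realType) (U : nonprincipal_ultrafilter).
Variable X : nat -> metricType R.

Definition ultraprod_eqv (x y : forall i, X i) : bool :=
  `[< (fun i => mdist (x i) (y i)) @ ultra U --> (0 : R) >].

Lemma ultraprod_eqv_refl : reflexive ultraprod_eqv.
Proof.
move=> x; apply/asboolP; under eq_fun do rewrite mdistxx.
exact: cvg_cst.
Qed.

Lemma ultraprod_eqv_sym : symmetric ultraprod_eqv.
Proof.
move=> x y; rewrite /ultraprod_eqv.
by under eq_fun do rewrite metric_sym.
Qed.

Lemma ultraprod_eqv_trans : transitive ultraprod_eqv.
Proof.
move=> y x z /asboolP xy /asboolP yz; apply/asboolP.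
have xyz : (fun i => mdist (x i) (y i) + mdist (y i) (z i)) @ ultra U
    --> (0 : R) by rewrite -[0]addr0; exact: cvgD.
apply: squeeze_cvgr (cvg_cst 0) xyz.
by apply: filterE => i; rewrite mdist_ge0 metric_triangle.
Qed.

Canonical ultraprod_equiv := EquivRel ultraprod_eqv
  ultraprod_eqv_refl ultraprod_eqv_sym ultraprod_eqv_trans.

Definition ultraprod := {eq_quot ultraprod_eqv}.

(* Independent of the representatives by ultradistE. *)
Definition ultradist (p q : ultraprod) : \bar R :=
  ultralim U (fun i => mdist (repr p i) (repr q i)).

Lemma ultraprod_piP (x y : forall i, X i) :
  \pi_ultraprod x = \pi_ultraprod y <->
  (fun i => mdist (x i) (y i)) @ ultra U --> (0 : R).
Proof.
have eqP := @eqmodP _ ultraprod_equiv x y.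
by split=> [/eqP/asboolP|/asboolP/eqP].
Qed.

Lemma ultraprod_reprP (x : forall i, X i) :
  (fun i => mdist (repr (\pi_ultraprod x) i) (x i)) @ ultra U --> (0 : R).
Proof. by apply/ultraprod_piP; rewrite reprK. Qed.

Lemma ultradistE (x y : forall i, X i) :
  ultradist (\pi x) (\pi y) = ultralim U (fun i => mdist (x i) (y i)).
Proof.
rewrite /ultradist; set x' := repr _; set y' := repr _.
pose d (u v : forall i, X i) i : R := mdist (u i) (v i).
have close u v u' v' (l : R) : d u u' @ ultra U --> (0 : R) ->
    d v v' @ ultra U --> (0 : R) -> d u v @ ultra U --> l -> d u' v' @ ultra U --> l.
  move=> uu vv uvl.
  have uvD : (fun i => d u u' i + d v v' i) @ ultra U --> (0 : R).
    by rewrite -[0]addr0; exact: cvgD.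
  have lo : (fun i => d u v i - (d u u' i + d v v' i)) @ ultra U --> l.
    by rewrite -[l]subr0; exact: cvgB.
  have hi : (fun i => d u v i + (d u u' i + d v v' i)) @ ultra U --> l.
    by rewrite -[l]addr0; exact: cvgD.
  apply: squeeze_cvgr lo hi; apply: filterE => i /=; rewrite /d.
  have t1 := metric_triangle (u i) (u' i) (v i).
  have t2 := metric_triangle (u' i) (v' i) (v i).
  have t3 := metric_triangle (u' i) (u i) (v' i).
  have t4 := metric_triangle (u i) (v i) (v' i).
  have := metric_sym (u i) (u' i); have := metric_sym (v i) (v' i).
  by move=> s1 s2; apply/andP; split; rewrite /=; lra.
have xx : d x' x @ ultra U --> (0 : R) by exact: ultraprod_reprP.
have yy : d y' y @ ultra U --> (0 : R) by exact: ultraprod_reprP.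
have xx' : d x x' @ ultra U --> (0 : R).
  by move: xx; rewrite /d; under eq_fun do rewrite metric_sym.
have yy' : d y y' @ ultra U --> (0 : R).
  by move: yy; rewrite /d; under eq_fun do rewrite metric_sym.
have [/cvg_ex[l dl]|ndxy] := pselect (cvg (d x y @ ultra U)).
  by rewrite (ultralim_cvg dl) (ultralim_cvg (close _ _ _ _ _ xx' yy' dl)).
have ndxy' : ~ cvg (d x' y' @ ultra U).
  case/cvg_ex=> l dl; apply: ndxy; apply/cvg_ex; exists l.
  exact: close xx yy dl.
by rewrite /ultralim !asboolF.
Qed.

(* Independent of the representative by extended_seqE. *)
Definition extended_seq (a : forall i, nat -> X i) (n : hypernat U) :
  ultraprod := \pi_ultraprod (fun i => a i (repr n i)).

Lemma extended_seqE (a : forall i, nat -> X i) (n : nat -> nat) :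
  extended_seq a (\pi n) = \pi_ultraprod (fun i => a i (n i)).
Proof.
apply/ultraprod_piP.
apply: (@cvg_trans _ ((fun=> 0 : R) @ ultra U)); last exact: cvg_cst.
apply: near_eq_cvg; move: (@hypernat_reprP U n); apply: filterS => i /= ->.
by rewrite mdistxx.
Qed.

Definition converges_in (b : hypernat U -> ultraprod) (I : set (hypernat U)) :
  Prop :=
  forall eps : R, 0 < eps -> exists2 n, I n &
    forall m, I m -> hn_lt n m -> (ultradist (b n) (b m) < eps%:E)%E.

End Ultraproduct.

(* Main.v *)
Require Import Defs.
From mathcomp Require Import all_boot all_order all_algebra.
From mathcomp Require Import all_classical all_reals all_analysis.
From mathcomp Require Import lra.

(** If the extended sequence does not converge in a cut [I] closed under [h],
then every element of [I] is followed in [I] by a jump whose size is bounded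
below; chaining [K] of these and picking one coordinate at which they are all
realised gives [K] jumps of a single sequence of the collection.  Conversely,
if the [i]-th sequence has [i] jumps, then the coordinatewise [k]-th jump
times, for standard [k], are cofinal in a cut closed under [h] in which
consecutive values of the extended sequence stay far apart. *)

Import Order.TTheory GRing.Theory Num.Theory.
Import numFieldNormedType.Exports.
Local Open Scope classical_set_scope.
Local Open Scope ring_scope.

(** Any ultrafilter refining [\oo] works: a principal one at [n] would have to put [n] in the tail
    beyond [n]. Tails are recorded because the jumps of the [i]-th sequence will be known only up to
    an index growing with [i]. *)
Lemma nonprincipal_ultrafilter_cofinite :
  exists U : nonprincipal_ultrafilter, forall N, ultra U [set i | (N < i)%N].
Proof.
have [G [UG ooG]] := ultraFilterLemma (F := \oo) _.
have GN N : G [set i | (N < i)%N] by apply: ooG; exact: nbhs_infty_gt.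
have Gnp n : G <> principal_filter n.
  move=> Gn; have := GN n; rewrite Gn => /principal_filterP /=.
  by rewrite ltnn.
by exists (NonprincipalUltrafilter UG Gnp).
Qed.

Lemma ultra_setC (T : Type) (F : set_system T) (A : set T) :
  UltraFilter F -> ~ F A -> F (~` A).
Proof. by move=> UF nA; case: (in_ultra_setVsetC A UF). Qed.

Lemma ultralim_lt_near (R : realType) (U : nonprincipal_ultrafilter)
    (r : nat -> R) (e : R) :
  (ultralim U r < e%:E)%E -> ultra U [set i | r i < e].
Proof.
rewrite /ultralim; case: asboolP => // cr; rewrite lte_fin => le.
exact: (cvgr_lt _ cr _ le).
Qed.

(** Nonnegativity makes [r] bounded on a set of the ultrafilter, so the limit is finite. Strict
    bounds become weak in the limit, hence the gap between [e] and [e']. *)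
Lemma near_lt_ultralim (R : realType) (U : nonprincipal_ultrafilter)
    (r : nat -> R) (e e' : R) :
  (forall i, 0 <= r i) -> e < e' -> ultra U [set i | r i < e] ->
  (ultralim U r < e'%:E)%E.
Proof.
move=> r0 ee' re.
have cr : cvg (r @ ultra U).
  apply/cvg_ultraP; exists e; apply: filterS re => i /= /ltW.
  by rewrite ger0_norm.
rewrite /ultralim asboolT// lte_fin (le_lt_trans _ ee')//.
by apply: limr_le => //; apply: filterS re => i /= /ltW.
Qed.

Lemma hypernat_witness (U : nonprincipal_ultrafilter) (n : hypernat U) :
  exists x : nat -> nat, n = \pi_(hypernat U)%qT x.
Proof. by exists (generic_quotient.repr n); rewrite generic_quotient.reprK. Qed.

(** Divergence at [x] itself might only yield a point before [h x], so it is applied at [z = h x],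
    giving [y] beyond [z] with values at least [eps / 2] apart. By the triangle inequality, [x] is
    then at least [eps / 4] away from [z] or from [y], and both lie far enough along to end a
    jump. *)
Lemma divergent_in_cut_jump (R : realType) (U : nonprincipal_ultrafilter)
    (X : nat -> metricType R) (a : forall i, nat -> X i) (h : nat -> nat)
    (h_gt : forall n, (n < h n)%N) (I : set (hypernat U)) (eps : R) :
  closed_under h I -> 0 < eps ->
  ~ (exists2 n, I n & forall m, I m -> hn_lt n m ->
      (ultradist (extended_seq a n) (extended_seq a m) < eps%:E)%E) ->
  forall x : nat -> nat, I (\pi x)%qT ->
  exists2 y : nat -> nat, I (\pi y)%qT &
    ultra U [set i | [/\ (x i < y i)%N, (h (x i) <= y i)%N &
                      eps / 4 <= mdist (a i (x i)) (a i (y i))]].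
Proof.
move=> hI eps0 div x Ix.
pose z i := h (x i).
have Iz : I (\pi z)%qT by have := hI _ Ix; rewrite hn_mapE.
have [y Iy [zy far]] : exists2 y : nat -> nat, I (\pi y)%qT &
    ultra U [set i | (z i < y i)%N] /\
    ultra U [set i | eps / 2 <= mdist (a i (z i)) (a i (y i))].
  apply: contrapT => nex; apply: div; exists (\pi z)%qT => // m.
  have [y ->] := hypernat_witness _ m => Iy /hn_ltE zy.
  rewrite !extended_seqE ultradistE.
  (* Were no such [y] to exist, the distances would be below [eps / 2] on a set of the ultrafilter
     for every [m] past [z], so [z] would witness convergence at [eps]. *)
  apply: (near_lt_ultralim _ _ _ (eps / 2)); [|lra|].
    by move=> i; exact: mdist_ge0.
  apply: contrapT => /ultra_setC far; apply: nex; exists y => //; split=> //.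
  by apply: filterS far => i /= /negP; rewrite -leNgt.
have [near_z|/ultra_setC far_z] := pselect
    (ultra U [set i | mdist (a i (x i)) (a i (z i)) < eps / 4]).
- exists y => //; apply: filterS3 near_z zy far => i /= xz zy zy_far.
  have xy := leq_ltn_trans (ltnW (h_gt (x i))) zy.
  split=> //; first exact: ltnW.
  have := metric_triangle (a i (z i)) (a i (x i)) (a i (y i)).
  by rewrite (metric_sym (a i (z i)) (a i (x i))); lra.
- exists z => //; apply: filterS far_z => i /= /negP; rewrite -leNgt => ?.
  by split=> //; exact: h_gt.
Qed.

Lemma jumps_converge_in_cut (R : realType) (U : nonprincipal_ultrafilter)
    (X : nat -> metricType R) (a : forall i, nat -> X i) (h : nat -> nat)
    (h_gt : forall n, (n < h n)%N) :
  (forall eps : R, 0 < eps ->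
     exists K, forall i, ~ admits_jumps h eps K (a i)) ->
  forall I : set (hypernat U), is_cut I -> closed_under h I ->
    converges_in (extended_seq a) I.
Proof.
move=> bounded I [[n0 In0] _ _] hI eps eps0; apply: contrapT => div.
have eps40 : 0 < eps / 4 by lra.
have [K noK] := bounded _ eps40.
have [x0 n0E] := hypernat_witness _ n0; rewrite n0E in In0.
(* Representatives carry their membership in [I], so that the jump step can be iterated. *)
pose P := {x : nat -> nat | I (\pi x)%qT}.
have [next nextP] := choice (fun p : P =>
  let: exist2 y Iy yP := cid2 (divergent_in_cut_jump _ _ _ _ _ h_gt _ _
    hI eps0 div _ (svalP p)) in
  ex_intro (fun q : P => ultra U [set i |
    [/\ (sval p i < sval q i)%N, (h (sval p i) <= sval q i)%N &
     eps / 4 <= mdist (a i (sval p i)) (a i (sval q i))]]) (exist _ y Iy) yP).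
pose s k : P := iter k next (exist _ x0 In0).
(* Finitely many sets of the ultrafilter meet in one coordinate where all the jumps occur at
   once. *)
have all_jumps J : ultra U [set i | forall k, (k < J)%N ->
    [/\ (sval (s k) i < sval (s k.+1) i)%N,
        (h (sval (s k) i) <= sval (s k.+1) i)%N &
        eps / 4 <= mdist (a i (sval (s k) i)) (a i (sval (s k.+1) i))]].
  elim: J => [|J IH]; first exact: filterE.
  apply: filterS2 IH (nextP (s J)) => i /= IH sJ k.
  by rewrite ltnS leq_eqVlt => /predU1P[->//|]; exact: IH.
have [i ai] := filter_ex (all_jumps K).
by apply: (noK i); exists (fun k => sval (s k) i) => k /andP[_]; exact: ai.
Qed.

Lemma jumps_diverge_in_cut (R : realType) (U : nonprincipal_ultrafilter)
    (U_gt : forall N, ultra U [set i | (N < i)%N])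
    (X : nat -> metricType R) (a : forall i, nat -> X i) (h : nat -> nat)
    (h_mono : forall m n : nat, (m <= n)%N -> (h m <= h n)%N) (eps : R) :
  0 < eps -> (forall i, admits_jumps h eps i (a i)) ->
  exists I : set (hypernat U),
    [/\ is_cut I, closed_under h I & ~ converges_in (extended_seq a) I].
Proof.
move=> eps0 /choice[t jump].
pose T k : hypernat U := \pi_(hypernat U)%qT (fun i => t i k.+1).
pose I : set (hypernat U) := [set n | exists k, hn_le n (T k)].
(* Jump times are numbered from 1, and the jump leaving time [k.+1] is guaranteed once [k.+1 < i],
   which holds on a tail. *)
have near_jump k : ultra U [set i | [/\ (t i k.+1 < t i k.+2)%N,
    (h (t i k.+1) <= t i k.+2)%N &
    eps <= mdist (a i (t i k.+1)) (a i (t i k.+2))]].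
  by apply: filterS (U_gt k.+1) => i /= ki; exact: jump.
have IT k : I (T k) by exists k; apply/hn_leE; apply: filterE => i /=.
exists I; split.
- split; first by exists (T 0%N); exact: IT.
  + move=> n m mn [k]; move: mn.
    have [x ->] := hypernat_witness _ n; have [y ->] := hypernat_witness _ m.
    move=> /hn_leE yx /hn_leE xk; exists k; apply/hn_leE.
    by apply: filterS2 yx xk => i /= /leq_trans; exact.
  + move=> n [k]; have [x ->] := hypernat_witness _ n => /hn_leE xk.
    exists k.+1; rewrite hn_mapE; apply/hn_leE.
    by apply: filterS2 xk (near_jump k) => i /= xki [tk _ _]; exact: leq_ltn_trans tk.
(* Monotonicity of [h] gives [h n <= h (T k) <= T k.+1] whenever [n <= T k]. *)
- move=> n [k]; have [x ->] := hypernat_witness _ n => /hn_leE xk.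
  exists k.+1; rewrite hn_mapE; apply/hn_leE.
  apply: filterS2 xk (near_jump k) => i /= /h_mono xki [_ tk _].
  exact: leq_trans tk.
- move=> conv; have eps20 : 0 < eps / 2 by lra.
  have [n [k]] := conv _ eps20.
  have [x ->] := hypernat_witness _ n => /hn_leE xk close.
  (* Convergence controls only points strictly after [n], which may equal [T k]. So [T k.+1] and
     [T k.+2] are used: both would be within [eps / 2] of [n], yet they are [eps] apart. *)
  have xk1 : ultra U [set i | (x i < t i k.+2)%N].
    by apply: filterS2 xk (near_jump k) => i /= xki [tk _ _]; exact: leq_ltn_trans tk.
  have xk2 : ultra U [set i | (x i < t i k.+3)%N].
    by apply: filterS2 xk1 (near_jump k.+1) => i /= xki [tk _ _]; exact: ltn_trans tk.
  have close1 := close _ (IT k.+1) ((hn_ltE _ _ _).2 xk1).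
  have close2 := close _ (IT k.+2) ((hn_ltE _ _ _).2 xk2).
  rewrite !extended_seqE !ultradistE in close1 close2.
  have [i /= [[d1 d2] [_ _ d3]]] := filter_ex (filterI (filterI
    (ultralim_lt_near _ _ _ _ close1) (ultralim_lt_near _ _ _ _ close2)) (near_jump k.+1)).
  have := metric_triangle (a i (t i k.+2)) (a i (x i)) (a i (t i k.+3)).
  by rewrite (metric_sym (a i (t i k.+2)) (a i (x i))); lra.
Qed.

Theorem theorem5p3 (R : realType)
    (C : forall X : metricType R, (nat -> X) -> Prop)
    (h : nat -> nat)
    (h_mono : forall m n : nat, (m <= n)%N -> (h m <= h n)%N)
    (h_gt : forall n : nat, (n < h n)%N) :
  (forall eps : R, 0 < eps ->
     exists K : nat, forall (X : metricType R) (a : nat -> X),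
       C X a -> ~ admits_jumps h eps K a)
  <->
  (forall (U : nonprincipal_ultrafilter) (X : nat -> metricType R)
          (a : forall i : nat, nat -> X i),
     (forall i : nat, C (X i) (a i)) ->
     forall I : set (hypernat U), is_cut I -> closed_under h I ->
       converges_in (extended_seq a) I).
Proof.
split=> [bounded U X a Ca|conv eps eps0].
  apply: jumps_converge_in_cut => // eps eps0.
  have [K noK] := bounded _ eps0.
  by exists K => i; exact: noK.
apply: contrapT => unbounded.
(* Space and sequence are paired so that [choice] picks both at once; the pair chosen for [K = i]
   becomes the [i]-th factor of the ultraproduct. *)
have many K : exists Xa : {X : metricType R & nat -> X},
    C (projT1 Xa) (projT2 Xa) /\ admits_jumps h eps K (projT2 Xa).
  apply: contrapT => nex; apply: unbounded; exists K => X a Ca jumps.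
  by apply: nex; exists (existT _ X a).
have [Xa XaP] := choice many.
have [U U_gt] := nonprincipal_ultrafilter_cofinite.
have [I [cutI hI]] := jumps_diverge_in_cut R U U_gt (fun i => projT1 (Xa i))
  (fun i => projT2 (Xa i)) h h_mono eps eps0 (fun i => (XaP i).2).
by apply; apply: conv => // i; exact: (XaP i).1.
Qed.
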